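(* Let $\mathbb{K}\in\{\mathbb{R},\mathbb{C}\}$ and let $\Sigma=(E,A,B,C,D)$ be a descriptor system over $\mathbb{K}$ with $(E,A)$ regular and of index at most one, and let $T_l,T_r\in\mathbb{K}^{n\times n}$ be invertible matrices with $$T_lET_r=\begin{bmatrix} E_1 & 0 \\ 0 & 0 \end{bmatrix},\quad T_lAT_r=\begin{bmatrix} A_1 & 0 \\ 0 & A_2 \end{bmatrix},\quad T_lB=\begin{bmatrix} B_1 \\ B_2 \end{bmatrix},\quad CT_r=[C_1,\,C_2],$$ where $n=n_1+n_2$ and $E_1\in\mathbb{K}^{n_1\times n_1}$, $A_2\in\mathbb{K}^{n_2\times n_2}$ are invertible. Then the modified KYP inequality $$\begin{bmatrix} -A_1^HQ_1-Q_1^HA_1 & C_1^H-Q_1^HB_1 \\ C_1-B_1^HQ_1 & (D-C_2A_2^{-1}B_2)+(D-C_2A_2^{-1}B_2)^H \end{bmatrix}\ge 0,\qquad x_1^HE_1^HQ_1x_1\ge 0\ \text{ for all } x_1\in\mathbb{K}^{n_1},$$ has a solution $Q_1\in\mathbb{K}^{n_1\times n_1}$ if and only if $\Sigma$ is passive, i.e. satisfies (Pa). Moreover, if $\Sigma$ is behaviorally observable, i.e. $\operatorname{rk}\begin{bmatrix} \lambda E-A \\ C \end{bmatrix}=n$ for all $\lambda\in\mathbb{C}$, then every solution $Q_1$ of this inequality is invertible.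
   Context: A descriptor system $\Sigma=(E,A,B,C,D)$ over $\mathbb{K}$ is given by $E,A\in\mathbb{K}^{n\times n}$, $B\in\mathbb{K}^{n\times m}$, $C\in\mathbb{K}^{m\times n}$, $D\in\mathbb{K}^{m\times m}$ and stands for $$\tfrac{d}{dt}Ex(t)=Ax(t)+Bu(t),\quad x(0)=x_0,\qquad y(t)=Cx(t)+Du(t). \quad ( * )$$ $(E,A)$ is regular if $\lambda E-A$ is invertible for some $\lambda\in\mathbb{C}$. Index at most one means that in the Kronecker–Weierstraß form of $(E,A)$, $\left(\begin{bmatrix} I_r & 0 \\ 0 & N \end{bmatrix},\begin{bmatrix} J & 0 \\ 0 & I_{n-r} \end{bmatrix}\right)$ with $N$ nilpotent, the block $N$ is zero or absent. $M^H$ is the conjugate transpose; for a Hermitian matrix $M$, $M\ge 0$ means positive semidefinite. (Pa) (passivity): there is $Q\in\mathbb{K}^{n\times n}$ such that $\mathcal{S}(x)=\tfrac12x^HQ^HEx$ satisfies, for all $T\ge 0$, $$\mathcal{S}(x(T))-\mathcal{S}(x(0))\le\int_0^T\operatorname{Re}\,y(\tau)^Hu(\tau)\,d\tau,\qquad \mathcal{S}(x(T))\ge 0,$$ for all consistent initial values $x_0$ and all infinitely differentiable functions $x,u,y$ fulfilling $( * )$ with $x(0)=x_0$. (An initial value $x_0$ is consistent if such a solution exists.)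
   Formalization: For K = ℝ the solution Q_1 in the equivalence is also required to make E_1^H Q_1 symmetric, since otherwise the equivalence is false over ℝ; the case K = ℂ and the invertibility claim are as stated. *)

(* Defs.v *)
From HB Require Import structures.
From mathcomp Require Import all_boot all_order all_algebra.
From mathcomp Require Import spectral sesquilinear complex.
From mathcomp Require Import all_classical all_reals all_analysis.
Set Implicit Arguments.
Unset Strict Implicit.
Unset Printing Implicit Defensive.
Import Order.TTheory GRing.Theory Num.Theory.
Import numFieldNormedType.Exports.
Local Open Scope ring_scope.
Local Open Scope complex_scope.
Local Open Scope sesquilinear_scope.
Local Open Scope classical_set_scope.

(* Both fields are treated inside C = R[i]: a matrix over the reals is a matrix
   over R[i] all of whose entries are real. On such matrices the conjugate
   transpose M ^t* is the transpose. Recall that in R[i] the inequality x <= y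
   means that Im x = Im y and Re x <= Re y, so that it forces x - y to be
   real. *)
Variant scalar_field := RealField | ComplexField.

Section Matrices.
Context {R : realType}.
Implicit Types K : scalar_field.

Definition mx_over K m n (M : 'M[R[i]]_(m, n)) : bool :=
  match K with
  | RealField => M \is a realmx
  | ComplexField => true
  end.

Definition hform n (M : 'M[R[i]]_n) (x : 'cV[R[i]]_n) : R[i] :=
  (x ^t* *m M *m x) 0 0.

Definition psdmx K n (M : 'M[R[i]]_n) : Prop :=
  M \is hermsymmx /\
  (forall x : 'cV[R[i]]_n, mx_over K x -> 0 <= hform M x).

Definition regular n (E A : 'M[R[i]]_n) : Prop :=
  exists lambda : R[i], lambda *: E - A \in unitmx.

Definition Kronecker_Weierstrass n (E A S T : 'M[R[i]]_n) r s
    (ers : (r + s)%N = n) (J : 'M[R[i]]_r) (N : 'M[R[i]]_s) : Prop :=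
  [/\ S \in unitmx, T \in unitmx, exists k : nat, N ^+ k = 0,
      S *m E *m T = castmx (ers, ers) (block_mx 1%:M 0 0 N)
    & S *m A *m T = castmx (ers, ers) (block_mx J 0 0 1%:M)].

(* The block N is absent when s = 0. *)
Definition index_le1 n (E A : 'M[R[i]]_n) : Prop :=
  exists (S T : 'M[R[i]]_n) (r s : nat) (ers : (r + s)%N = n)
         (J : 'M[R[i]]_r) (N : 'M[R[i]]_s),
    Kronecker_Weierstrass E A S T ers J N /\ N = 0.

Definition behaviorally_observable n m (E A : 'M[R[i]]_n)
    (C : 'M[R[i]]_(m, n)) : Prop :=
  forall lambda : R[i], \rank (col_mx (lambda *: E - A) C) = n.

End Matrices.

Section Trajectories.
Context {R : realType}.
Implicit Types K : scalar_field.

Definition smooth_real (f : R -> R) : Prop :=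
  forall (k : nat) (t : R), derivable (f^`(k)) t 1.

Definition smooth n (x : R -> 'cV[R[i]]_n) : Prop :=
  forall i, smooth_real (fun t => complex.Re (x t i 0)) /\
            smooth_real (fun t => complex.Im (x t i 0)).

Definition ddt n (x : R -> 'cV[R[i]]_n) (t : R) : 'cV[R[i]]_n :=
  \col_i ((fun s => complex.Re (x s i 0))^`() t
          +i* (fun s => complex.Im (x s i 0))^`() t).

(* The system runs on the time axis [0, +oo[; a smooth function on [0, +oo[ is
   represented by a smooth extension to R, about which nothing else is
   required for t < 0. *)
Definition solution K n m (E A : 'M[R[i]]_n) (B : 'M[R[i]]_(n, m))
    (C : 'M[R[i]]_(m, n)) (D : 'M[R[i]]_m) (x0 : 'cV[R[i]]_n)
    (x : R -> 'cV[R[i]]_n) (u y : R -> 'cV[R[i]]_m) : Prop :=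
  [/\ forall t, [&& mx_over K (x t), mx_over K (u t) & mx_over K (y t)],
      [/\ smooth x, smooth u & smooth y],
      forall t, 0 <= t ->
        ddt (fun s => E *m x s) t = A *m x t + B *m u t,
      x 0 = x0
    & forall t, 0 <= t -> y t = C *m x t + D *m u t].

Definition consistent K n m (E A : 'M[R[i]]_n) (B : 'M[R[i]]_(n, m))
    (C : 'M[R[i]]_(m, n)) (D : 'M[R[i]]_m) (x0 : 'cV[R[i]]_n) : Prop :=
  exists (x : R -> 'cV[R[i]]_n) (u y : R -> 'cV[R[i]]_m),
    solution K E A B C D x0 x u y.

Definition storage n (E Q : 'M[R[i]]_n) (x : 'cV[R[i]]_n) : R[i] :=
  2^-1 * hform (Q ^t* *m E) x.

Definition supply m (u y : R -> 'cV[R[i]]_m) (T : R) : R :=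
  \int[lebesgue_measure]_(t in `[0, T])
    complex.Re (((y t) ^t* *m u t) 0 0).

Definition passive K n m (E A : 'M[R[i]]_n) (B : 'M[R[i]]_(n, m))
    (C : 'M[R[i]]_(m, n)) (D : 'M[R[i]]_m) : Prop :=
  exists Q : 'M[R[i]]_n, mx_over K Q /\
    forall x0 : 'cV[R[i]]_n, consistent K E A B C D x0 ->
    forall (x : R -> 'cV[R[i]]_n) (u y : R -> 'cV[R[i]]_m),
      solution K E A B C D x0 x u y ->
    forall T : R, 0 <= T ->
      storage E Q (x T) - storage E Q (x 0) <= (supply u y T)%:C /\
      0 <= storage E Q (x T).

End Trajectories.

Section ModifiedKYP.
Context {R : realType}.

Definition modified_KYP (K : scalar_field) n1 n2 m
    (E1 A1 : 'M[R[i]]_n1) (A2 : 'M[R[i]]_n2)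
    (B1 : 'M[R[i]]_(n1, m)) (B2 : 'M[R[i]]_(n2, m))
    (C1 : 'M[R[i]]_(m, n1)) (C2 : 'M[R[i]]_(m, n2))
    (D : 'M[R[i]]_m) (Q1 : 'M[R[i]]_n1) : Prop :=
  let D' := D - C2 *m invmx A2 *m B2 in
  psdmx K (block_mx
    (- (A1 ^t* *m Q1) - Q1 ^t* *m A1)  (C1 ^t* - Q1 ^t* *m B1)
    (C1 - B1 ^t* *m Q1)                (D' + D' ^t*)) /\
  (forall x1 : 'cV[R[i]]_n1, mx_over K x1 -> 0 <= hform (E1 ^t* *m Q1) x1).

End ModifiedKYP.

(* Main.v *)
(* In the coordinates x = Tr (v1, v2) the system is E1 v1' = A1 v1 + B1 u with
   v2 = - A2^-1 B2 u and y = C1 v1 + D' u, where D' = D - C2 A2^-1 B2. If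
   E1^H Q1 is Hermitian, the KYP form at (v1, u) is twice the supply rate minus
   twice the derivative of the storage v1^H E1^H Q1 v1 / 2. So KYP integrates to
   the dissipation inequality, and conversely the dissipation inequality on
   [0, T] gives KYP at (v1(0), u(0)) as T -> 0, since every initial pair
   (v1, u) is realised by a trajectory with constant input. A storage
   x^H Q^H E x may also contain a term bilinear in v2 and v1; it is real-linear
   in u, so nonnegativity of the storage forces it to vanish.
   For the last claim, a vector of ker Q1 is isotropic for both semidefinite
   forms, which puts E1 ker Q1 and A1 ker Q1 in ker Q1^H and ker Q1 in ker C1.
   By dimension E1 ker Q1 = ker Q1^H, so ker Q1 is invariant under E1^-1 A1, and
   an eigenvector in it would contradict observability. *)

Require Import Defs.
From HB Require Import structures.
From mathcomp Require Import all_boot all_order all_algebra.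
From mathcomp Require Import spectral sesquilinear complex.
From mathcomp Require Import all_classical all_reals all_analysis.
From mathcomp Require Import ring lra.
Set Implicit Arguments.
Unset Strict Implicit.
Unset Printing Implicit Defensive.
Import Order.TTheory GRing.Theory Num.Theory.
Import numFieldNormedType.Exports.
Local Open Scope ring_scope.
Local Open Scope complex_scope.
Local Open Scope sesquilinear_scope.

(** * Integral comparison and exponential generating functions on the real line *)

Section RealFunctions.
Context {R : realType}.


Lemma derivable_continuousR (f : R -> R) :
  (forall t, derivable f t 1) -> continuous f.
Proof.
by move=> df t; apply: differentiable_continuous; apply/derivable1_diffP.
Qed.

(** The fundamental theorem of calculus turns the increment into an integral, and the integral is
    monotone. This carries a pointwise dissipation rate to the dissipation inequality. *)
Lemma is_derive_increment_le (s s' g : R -> R) :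
    (forall t : R, is_derive t 1 s (s' t)) -> continuous s' -> continuous g ->
    (forall t, 0 <= t -> s' t <= g t) ->
  forall T, 0 <= T -> s T - s 0 <= \int[lebesgue_measure]_(t in `[0, T]) g t.
Proof.
move=> ds cs cg sg T; rewrite le_eqVlt => /predU1P[<-|T0].
  by rewrite set_itv1 Rintegral_set1 subrr.
have sE : \int[lebesgue_measure]_(t in `[0, T]) s' t = s T - s 0.
  rewrite /Rintegral (@continuous_FTC2 _ s' s)//.
  - by apply: continuous_subspaceT.
  - have c := @derivable_continuousR s
      (fun t => @ex_derive _ _ _ _ _ _ _ (ds t)).
    split=> [t _||].
    + exact: ex_derive.
    + by apply: cvg_at_right_filter; exact: c.
    + by apply: cvg_at_left_filter; exact: c.
  - by move=> t _; rewrite derive1E derive_val.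
rewrite -sE; apply: le_Rintegral => //.
- apply: continuous_compact_integrable; first exact: segment_compact.
  exact: continuous_subspaceT.
- apply: continuous_compact_integrable; first exact: segment_compact.
  exact: continuous_subspaceT.
- by move=> t; rewrite /= in_itv/= => /andP[t0 _]; exact: sg.
Qed.

(** Otherwise a constant [c] strictly between [g 0] and [s' 0] separates the two functions on a
    short interval. There the mean value theorem puts the increment above [c] times the length, and
    the integral is at most that. *)
Lemma is_derive_le_of_increment (s s' g : R -> R) :
    (forall t : R, is_derive t 1 s (s' t)) -> continuous s' -> continuous g ->
    (forall T, 0 <= T ->
       s T - s 0 <= \int[lebesgue_measure]_(t in `[0, T]) g t) ->
  s' 0 <= g 0.
Proof.
move=> ds cs cg sg; rewrite leNgt; apply/negP => gs.
pose c := (s' 0 + g 0) / 2.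
have cs' : c < s' 0 by rewrite /c; lra.
have cg' : g 0 < c by rewrite /c; lra.
have : \forall t \near (0 : R), c < s' t /\ g t < c.
  near=> t; split; near: t.
  - exact: (cvgr_gt _ (cs 0)).
  - exact: (cvgr_lt _ (cg 0)).
move=> /nbhs_ballP[e /= e0 be].
have T0 : 0 < e / 2 by rewrite divr_gt0.
have Tb t : 0 <= t <= e / 2 -> c < s' t /\ g t < c.
  move=> /andP[t0 te]; apply: be; rewrite /ball/= sub0r normrN ger0_norm//; lra.
have := sg _ (ltW T0); apply/negP; rewrite -ltNge.
have [x xI ->] := @MVT _ s s' 0 (e / 2) T0 (fun t _ => ds t)
  (continuous_subspaceT (@derivable_continuousR s
     (fun t => @ex_derive _ _ _ _ _ _ _ (ds t)))).
have {xI} : 0 <= x <= e / 2.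
  by move: xI; rewrite in_itv/= => /andP[/ltW-> /ltW->].
move=> /Tb[cx _]; rewrite subr0.
apply: (@le_lt_trans _ _ (c * (e / 2))); last by rewrite ltr_pM2r.
have -> : c * (e / 2) = \int[lebesgue_measure]_(t in `[0, (e / 2)%R]) c.
  rewrite Rintegral_cst//= lebesgue_measure_itv/= lte_fin T0 /=; congr (_ * _).
  by rewrite oppr0 addr0.
apply: le_Rintegral => //.
- apply: continuous_compact_integrable; first exact: segment_compact.
  exact: continuous_subspaceT.
- apply: continuous_compact_integrable; first exact: segment_compact.
  by apply: continuous_subspaceT => x'; exact: cvg_cst.
- by move=> t; rewrite /= in_itv/= => /Tb[_ /ltW].
Unshelve. all: by end_near. Qed.

(* Differentiation shifts the sequence, so that taking for [a] the iterates of a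
   matrix on a vector solves the linear ODE. *)
Definition egf (a : nat -> R) (t : R) : R :=
  limn (pseries (fun k => a k / k`!%:R) t).

(** A growth condition stable under shifts and finite linear combinations. The case [k = 0] forces
    [0 <= b]; the sign of [r] is left open. *)
Definition geometrically_bounded (a : nat -> R) : Prop :=
  exists b r : R, forall k, `|a k| <= b * r ^+ k.

Lemma geometrically_bounded_shift (a : nat -> R) :
  geometrically_bounded a -> geometrically_bounded (fun k => a k.+1).
Proof.
move=> [b [r abr]]; exists (b * r), r => k.
by rewrite -mulrA -exprS; exact: abr.
Qed.

(** Comparison with [b] times the exponential series at [|r * t|]. *)
Lemma pseries_egf_cvg (a : nat -> R) (t : R) :
  geometrically_bounded a -> cvgn (pseries (fun k => a k / k`!%:R) t).
Proof.
move=> [b [r abr]]; apply: normed_cvg.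
apply: (@series_le_cvg _ _ (b *: exp_coeff `|r * t|)).
- by move=> n; rewrite /= normr_ge0.
- move=> n; rewrite /= mulr_ge0// ?exp_coeff_ge0//.
  by have := le_trans (normr_ge0 _) (abr 0); rewrite expr0 mulr1.
- move=> n /=.
  have b0 : 0 <= b.
    by have := le_trans (normr_ge0 _) (abr 0); rewrite expr0 mulr1.
  have h : `|a n| <= b * `|r| ^+ n.
    by apply: le_trans (abr n) _; rewrite ler_wpM2l// -normrX; exact: ler_norm.
  have -> : (b *: exp_coeff `|r * t|) n =
      b * `|r| ^+ n * (n`!%:R^-1 * `|t| ^+ n).
    have -> : (b *: exp_coeff `|r * t|) n = b * (`|r * t| ^+ n / n`!%:R) by [].
    by rewrite normrM exprMn; ring.
  rewrite !normrM normfV normrX [`|n`!%:R|]ger0_norm// -[leLHS]mulrA.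
  by rewrite ler_wpM2r// mulr_ge0// ?exprn_ge0// invr_ge0.
- have := @is_cvg_seriesZ _ _ b (is_cvg_series_exp_coeff `|r * t|); exact.
Qed.

Lemma is_derive_egf (a : nat -> R) (t : R) : geometrically_bounded a ->
  is_derive t 1 (egf a) (egf (fun k => a k.+1) t).
Proof.
have dE (c : nat -> R) : pseries_diffs (fun k => c k / k`!%:R) =
    (fun k => c k.+1 / k`!%:R).
  apply/funext => k; rewrite /pseries_diffs factS natrM invfM.
  by rewrite mulrCA mulVKf.
move=> ba; rewrite /egf -dE.
have ba1 := geometrically_bounded_shift ba.
have ba2 := geometrically_bounded_shift ba1.
(* Termwise differentiation at [t] asks that the series and its first two formal derivatives
   converge at some point of larger modulus; [|t| + 1] serves. *)
apply: (@pseries_snd_diffs _ _ (`|t| + 1)); rewrite ?dE;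
  try exact: pseries_egf_cvg.
by rewrite [ltRHS]ger0_norm ?addr_ge0// ltrDl.
Qed.

Lemma egf0 (a : nat -> R) : geometrically_bounded a -> egf a 0 = a 0.
Proof.
(* The partial sum of index 0 is empty; all later ones equal [a 0], hence the shift. *)
move=> ba; apply/cvg_lim => //; rewrite -cvg_shiftS.
apply: cvg_near_cst; apply: nearW => n.
rewrite /pseries /series /= big_nat_recl//= expr0 fact0 divr1 mulr1.
rewrite big1 ?addr0//.
by move=> i _; rewrite expr0n mulr0.
Qed.

Lemma egf_sum (I : finType) (c : I -> R) (a : I -> nat -> R) t :
    (forall i, geometrically_bounded (a i)) ->
  egf (fun k => \sum_i c i * a i k) t = \sum_i c i * egf (a i) t.
Proof.
move=> ba; apply/cvg_lim => //.
have -> : pseries (fun k => (\sum_i c i * a i k) / k`!%:R) t =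
    (fun n => \sum_i c i * pseries (fun k => a i k / k`!%:R) t n).
  apply/funext => n; rewrite /pseries /series /=.
  under [RHS]eq_bigr do rewrite mulr_sumr.
  rewrite exchange_big /=; apply: eq_bigr => k _.
  rewrite !mulr_suml; apply: eq_bigr => i _; ring.
apply: (@cvg_big R^o _ +%R) => [|i _]; first exact: add_continuous.
by apply: cvgMl_tmp; exact: pseries_egf_cvg.
Qed.

Lemma egfD (a b : nat -> R) (t : R) :
    geometrically_bounded a -> geometrically_bounded b ->
  egf (fun k => a k + b k) t = egf a t + egf b t.
Proof.
move=> ba bb.
have bi (i : bool) : geometrically_bounded (if i then a else b) by case: i.
have := @egf_sum bool (fun=> 1) _ t bi.
rewrite !big_bool/= !mul1r => <-; congr egf; apply/funext => k.
by rewrite big_bool/= !mul1r.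
Qed.

Lemma egf_cst0 (t : R) : egf (fun=> 0) t = 0.
Proof.
have b0 : geometrically_bounded (fun=> 0 : R).
  by exists 0, 0 => k; rewrite normr0 mul0r.
by have := egfD t b0 b0; rewrite addr0 => /eqP; rewrite addrC -subr_eq subrr
  => /eqP.
Qed.

Lemma smooth_egf (a : nat -> R) :
  geometrically_bounded a -> smooth_real (egf a).
Proof.
move=> ba k t.
(* The growth bound joins the induction because each further differentiation uses it for the shifted
   sequence. *)
have dk : (egf a)^`(k)%classic = egf (fun i => a (k + i)%N) /\
    geometrically_bounded (fun i => a (k + i)%N).
  elim: k => [|k [IH bk]]; first by split.
  split; last first.
    by have := geometrically_bounded_shift bk; under eq_fun do rewrite addnS.
  rewrite derive1nS IH; apply/funext => x.
  rewrite derive1E; have := is_derive_egf x bk.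
  by under [X in egf X x]eq_fun do rewrite addnS; move=> /@derive_val.
by case: dk => -> bk; apply: ex_derive; exact: is_derive_egf.
Qed.

End RealFunctions.

(** * Derivatives of complex matrix functions of a real variable *)

Section ComplexFunctions.
Context {R : realType}.
Notation Re := complex.Re.
Notation Im := complex.Im.

Lemma ReD (x y : R[i]) : Re (x + y) = Re x + Re y.
Proof. by case: x; case: y. Qed.

Lemma ImD (x y : R[i]) : Im (x + y) = Im x + Im y.
Proof. by case: x; case: y. Qed.

Lemma ReM (x y : R[i]) : Re (x * y) = Re x * Re y - Im x * Im y.
Proof. by case: x; case: y. Qed.

Lemma ImM (x y : R[i]) : Im (x * y) = Re x * Im y + Im x * Re y.
Proof. by case: x; case: y. Qed.

Lemma Re_sum (I : finType) (f : I -> R[i]) : Re (\sum_i f i) = \sum_i Re (f i).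
Proof. exact: (big_morph _ ReD). Qed.

Lemma Im_sum (I : finType) (f : I -> R[i]) : Im (\sum_i f i) = \sum_i Im (f i).
Proof. exact: (big_morph _ ImD). Qed.

Lemma Re_conj (x : R[i]) : Re (x^*)%R = Re x.
Proof. by case: x. Qed.

Lemma Im_conj (x : R[i]) : Im (x^*)%R = - Im x.
Proof. by case: x. Qed.

Lemma realE (x : R[i]) : (x \is Num.real) = (Im x == 0).
Proof. by case: x => a b; rewrite complex_real. Qed.

Lemma complex_eqP (x y : R[i]) : Re x = Re y -> Im x = Im y -> x = y.
Proof. by case: x => a b; case: y => c d /= -> ->. Qed.

(** Real and imaginary parts are separated as in [ddt]. General matrices are allowed so that one
    product rule also covers adjoints and quadratic forms, which are matrices of size 1. *)
Definition is_mxderive m n (t : R) (X : R -> 'M[R[i]]_(m, n))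
    (L : 'M[R[i]]_(m, n)) : Prop :=
  forall i j, is_derive t (1 : R) (fun s => Re (X s i j)) (Re (L i j)) /\
              is_derive t (1 : R) (fun s => Im (X s i j)) (Im (L i j)).

Lemma is_mxderive_cst m n (t : R) (M : 'M[R[i]]_(m, n)) :
  is_mxderive t (fun=> M) 0.
Proof. by move=> i j; rewrite mxE; split; exact: is_derive_cst. Qed.

Lemma is_mxderive_adj m n (t : R) (X : R -> 'M[R[i]]_(m, n)) L :
  is_mxderive t X L -> is_mxderive t (fun s => (X s)^t*) (L ^t*).
Proof.
move=> dX i j; have [dR dI] := dX j i; rewrite !mxE Re_conj Im_conj.
split.
  by under [X in is_derive _ _ X]eq_fun do rewrite !mxE Re_conj.
under [X in is_derive _ _ X]eq_fun do rewrite !mxE Im_conj.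
exact: is_deriveN.
Qed.

Lemma is_mxderiveM m n p (t : R) (X : R -> 'M[R[i]]_(m, n))
    (Y : R -> 'M[R[i]]_(n, p)) L M :
  is_mxderive t X L -> is_mxderive t Y M ->
  is_mxderive t (fun s => X s *m Y s) (L *m Y t + X t *m M).
Proof.
move=> dX dY i j; split.
  have -> : (fun s => Re ((X s *m Y s) i j)) =
      \sum_(k < n) ((fun s => Re (X s i k)) * (fun s => Re (Y s k j)) -
                    (fun s => Im (X s i k)) * (fun s => Im (Y s k j))).
    apply/funext => s; rewrite mxE Re_sum fct_sumE; apply: eq_bigr => k _.
    by rewrite ReM.
  apply: (@is_derive_eq _ _ _ _ _ _ _ _ (is_derive_sum _)).
    move=> k; have [xR xI] := dX i k; have [yR yI] := dY k j.
    by apply: is_deriveB; apply: is_deriveM.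
  rewrite !mxE ReD !Re_sum -big_split /=; apply: eq_bigr => k _.
  by rewrite !ReM /GRing.scale/=; ring.
have -> : (fun s => Im ((X s *m Y s) i j)) =
    \sum_(k < n) ((fun s => Re (X s i k)) * (fun s => Im (Y s k j)) +
                  (fun s => Im (X s i k)) * (fun s => Re (Y s k j))).
  apply/funext => s; rewrite mxE Im_sum fct_sumE; apply: eq_bigr => k _.
  by rewrite ImM.
apply: (@is_derive_eq _ _ _ _ _ _ _ _ (is_derive_sum _)).
  move=> k; have [xR xI] := dX i k; have [yR yI] := dY k j.
  by apply: is_deriveD; apply: is_deriveM.
rewrite !mxE ImD !Im_sum -big_split /=; apply: eq_bigr => k _.
by rewrite !ImM /GRing.scale/=; ring.
Qed.

Lemma is_mxderiveMl m n p (t : R) (M : 'M[R[i]]_(m, n))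
    (X : R -> 'M[R[i]]_(n, p)) L :
  is_mxderive t X L -> is_mxderive t (fun s => M *m X s) (M *m L).
Proof.
by move=> /(is_mxderiveM (is_mxderive_cst t M)); rewrite mul0mx add0r.
Qed.

Lemma is_mxderive_ddt n (t : R) (x : R -> 'cV[R[i]]_n) L :
  is_mxderive t x L -> ddt x t = L.
Proof.
move=> dx; apply/colP => i; have [dR dI] := dx i 0.
by rewrite mxE !derive1E !derive_val; apply: complex_eqP.
Qed.

Lemma smooth_is_mxderive n (x : R -> 'cV[R[i]]_n) (t : R) :
  smooth x -> is_mxderive t x (ddt x t).
Proof.
move=> sx i j; rewrite ord1 !mxE/=; have [sR sI] := sx i.
by rewrite !derive1E; split; apply: derivableP; [exact: (sR 0)|exact: (sI 0)].
Qed.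

Lemma smooth_ddt n (x : R -> 'cV[R[i]]_n) : smooth x -> smooth (ddt x).
Proof.
move=> sx i; have [sR sI] := sx i; split=> k t.
  under [X in derive1n _ X]eq_fun do rewrite mxE/=.
  by have := sR k.+1 t; rewrite /derive1n iterSr.
under [X in derive1n _ X]eq_fun do rewrite mxE/=.
by have := sI k.+1 t; rewrite /derive1n iterSr.
Qed.

Lemma is_mxderive_continuous_Re m n (X : R -> 'M[R[i]]_(m, n)) L i j :
  (forall t, is_mxderive t X (L t)) -> continuous (fun t => Re (X t i j)).
Proof.
move=> dX; apply: derivable_continuousR => t.
by have [dR _] := dX t i j; exact: ex_derive.
Qed.

End ComplexFunctions.

(** * Matrix exponentials applied to vectors, as entrywise generating functions *)

Section LinearFlow.
Context {R : realType}.
Notation Re := complex.Re.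
Notation Im := complex.Im.

Lemma normr_Re_le (z : R[i]) (b : R) : `|z| <= b%:C -> `|Re z| <= b.
Proof.
rewrite normc_def lecR; apply: le_trans; rewrite -sqrtr_sqr ler_sqrt.
  by rewrite lerDl sqr_ge0.
by rewrite addr_ge0// sqr_ge0.
Qed.

Lemma normr_Im_le (z : R[i]) (b : R) : `|z| <= b%:C -> `|Im z| <= b.
Proof.
rewrite normc_def lecR; apply: le_trans; rewrite -sqrtr_sqr ler_sqrt.
  by rewrite lerDr sqr_ge0.
by rewrite addr_ge0// sqr_ge0.
Qed.

Definition mx_geometrically_bounded n (a : nat -> 'cV[R[i]]_n) : Prop :=
  exists b r : R, forall k i, `|a k i 0| <= (b * r ^+ k)%:C.

Lemma mx_geometrically_bounded_Re n (a : nat -> 'cV[R[i]]_n) i :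
  mx_geometrically_bounded a -> geometrically_bounded (fun k => Re (a k i 0)).
Proof. by move=> [b [r h]]; exists b, r => k; exact: normr_Re_le. Qed.

Lemma mx_geometrically_bounded_Im n (a : nat -> 'cV[R[i]]_n) i :
  mx_geometrically_bounded a -> geometrically_bounded (fun k => Im (a k i 0)).
Proof. by move=> [b [r h]]; exists b, r => k; exact: normr_Im_le. Qed.

(** The sum of the moduli of all entries dominates every row sum, hence bounds the operator norm for
    the maximum norm. *)
Lemma mulmx_entry_le m n (M : 'M[R[i]]_(m, n)) :
  exists2 mu : R, 0 <= mu & forall (v : 'cV[R[i]]_n) (b : R[i]),
    (forall j, `|v j 0| <= b) -> 0 <= b ->
    forall i, `|(M *m v) i 0| <= mu%:C * b.
Proof.
pose mu := \sum_i \sum_j `|M i j|.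
have mu_ge0 : 0 <= mu by apply: sumr_ge0 => i _; exact: sumr_ge0.
exists (Re mu); first by move: mu_ge0; rewrite lecE => /andP[].
move=> v b vb b0 i; rewrite RRe_real ?ger0_real// mxE.
apply: le_trans (ler_norm_sum _ _ _) _.
apply: (@le_trans _ _ ((\sum_j `|M i j|) * b)).
  by rewrite mulr_suml; apply: ler_sum => j _; rewrite normrM ler_wpM2l.
rewrite ler_wpM2r// /mu (bigD1 i)//= lerDl.
by apply: sumr_ge0 => k _; exact: sumr_ge0.
Qed.

Lemma mx_geometrically_bounded_mulmx m n (L : 'M[R[i]]_(m, n)) a :
  mx_geometrically_bounded a -> mx_geometrically_bounded (fun k => L *m a k).
Proof.
have [mu mu0 Lmu] := mulmx_entry_le L.
(* Absolute values make the bound at each [k] nonnegative, as [Lmu] demands. *)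
move=> [b [r h]]; exists (mu * `|b|), `|r| => k i.
rewrite -mulrA rmorphM; apply: Lmu; last first.
  by rewrite ler0c mulr_ge0// exprn_ge0.
move=> j; apply: le_trans (h k j) _; rewrite lecR.
by apply: le_trans (ler_norm _) _; rewrite normrM normrX.
Qed.

(** Each application of [M] multiplies the bound by [mu], starting from the sum of the moduli of
    [z]. *)
Lemma mx_geometrically_bounded_iter n (M : 'M[R[i]]_n) (z : 'cV[R[i]]_n) :
  mx_geometrically_bounded (fun k => iter k (mulmx M) z).
Proof.
have [mu mu0 Mmu] := mulmx_entry_le M.
pose b := \sum_i `|z i 0|.
have b_ge0 : 0 <= b by exact: sumr_ge0.
exists (Re b), mu; elim=> [|k IH] i.
  rewrite expr0 mulr1 RRe_real ?ger0_real// /b (bigD1 i)//= lerDl.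
  exact: sumr_ge0.
rewrite iterS exprS mulrCA rmorphM; apply: Mmu => //.
rewrite ler0c mulr_ge0 ?exprn_ge0//.
by move: b_ge0; rewrite lecE => /andP[].
Qed.

Definition mx_egf n (a : nat -> 'cV[R[i]]_n) (t : R) : 'cV[R[i]]_n :=
  \col_i (egf (fun k => Re (a k i 0)) t +i* egf (fun k => Im (a k i 0)) t).

(** With [a] the iterates of a matrix on a vector and [L] that matrix, this identifies the shifted
    series with [L] times the original one, which is the differential equation. *)
Lemma mx_egf_mulmx m n (L : 'M[R[i]]_(m, n)) a (t : R) :
  mx_geometrically_bounded a ->
  mx_egf (fun k => L *m a k) t = L *m mx_egf a t.
Proof.
move=> ba; apply/colP => i; rewrite !mxE.
have bRe j := mx_geometrically_bounded_Re j ba.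
have bIm j := mx_geometrically_bounded_Im j ba.
have bsum (c : 'I_n -> R) (s : 'I_n -> nat -> R) :
    (forall j, geometrically_bounded (s j)) ->
    geometrically_bounded (fun k => \sum_j c j * s j k).
  move=> bs.
  pose B j := sval (cid (bs j)); pose r j := sval (cid (svalP (cid (bs j)))).
  have h j k : `|s j k| <= B j * r j ^+ k.
    exact: (svalP (cid (svalP (cid (bs j))))).
  (* The sum of the ratios is a common ratio dominating each [|r j|]. *)
  exists (\sum_j `|c j| * B j), (\sum_j `|r j|) => k.
  apply: le_trans (ler_norm_sum _ _ _) _; rewrite mulr_suml.
  apply: ler_sum => j _; rewrite normrM -mulrA ler_wpM2l//.
  apply: le_trans (h j k) _; rewrite ler_wpM2l//.
    by have := le_trans (normr_ge0 _) (h j 0); rewrite expr0 mulr1.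
  apply: le_trans (ler_norm _) _; rewrite normrX lerXn2r ?nnegrE ?sumr_ge0//.
  by rewrite (bigD1 j)//= lerDl sumr_ge0.
apply: complex_eqP => /=.
  rewrite Re_sum.
  under [X in egf X]eq_fun do (rewrite mxE Re_sum;
    under eq_bigr do rewrite ReM -mulNr; rewrite big_split/=).
  rewrite egfD ?egf_sum//; try exact: bsum.
  by rewrite -big_split; apply: eq_bigr => j _; rewrite !mxE ReM/= mulNr.
rewrite Im_sum.
under [X in egf X]eq_fun do (rewrite mxE Im_sum;
  under eq_bigr do rewrite ImM; rewrite big_split/=).
rewrite egfD ?egf_sum//; try exact: bsum.
by rewrite -big_split; apply: eq_bigr => j _; rewrite !mxE ImM.
Qed.

Lemma is_mxderive_egf n (a : nat -> 'cV[R[i]]_n) (t : R) :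
  mx_geometrically_bounded a ->
  is_mxderive t (mx_egf a) (mx_egf (fun k => a k.+1) t).
Proof.
move=> ba i j; rewrite ord1 !mxE/=.
split; under [X in is_derive _ _ X]eq_fun do rewrite mxE/=.
  exact: is_derive_egf (mx_geometrically_bounded_Re i ba).
exact: is_derive_egf (mx_geometrically_bounded_Im i ba).
Qed.

Lemma smooth_mx_egf n (a : nat -> 'cV[R[i]]_n) :
  mx_geometrically_bounded a -> smooth (mx_egf a).
Proof.
move=> ba i; split; under eq_fun do rewrite mxE/=; apply: smooth_egf.
  exact: mx_geometrically_bounded_Re.
exact: mx_geometrically_bounded_Im.
Qed.

Lemma mx_egf0 n (a : nat -> 'cV[R[i]]_n) :
  mx_geometrically_bounded a -> mx_egf a 0 = a 0.
Proof.
move=> ba; apply/colP => i; rewrite mxE !egf0; first by case: (a 0%N i 0).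
  exact: mx_geometrically_bounded_Im.
exact: mx_geometrically_bounded_Re.
Qed.

Lemma mx_over_egf K n (a : nat -> 'cV[R[i]]_n) (t : R) :
  (forall k, mx_over K (a k)) -> mx_over K (mx_egf a t).
Proof.
case: K => //= ra; apply/mxOverP => i j; rewrite mxE realE/=.
under [X in egf X]eq_fun => k.
  have /mxOverP/(_ i 0) := ra k; rewrite realE => /eqP ->; over.
by rewrite egf_cst0.
Qed.

End LinearFlow.

(** * Adjoints, the KYP form, and eigenvectors inside kernels *)

Section MatrixForms.
Context {C : numClosedFieldType}.

Lemma mxDE m n (M N : 'M[C]_(m, n)) i j : (M + N) i j = M i j + N i j.
Proof. by rewrite mxE. Qed.

Lemma mxNE m n (M : 'M[C]_(m, n)) i j : (- M) i j = - M i j.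
Proof. by rewrite mxE. Qed.

Lemma mxZE m n c (M : 'M[C]_(m, n)) i j : (c *: M) i j = c * M i j.
Proof. by rewrite mxE. Qed.

Lemma adjmxM m n p (M : 'M[C]_(m, n)) (N : 'M[C]_(n, p)) :
  (M *m N)^t* = N^t* *m M^t*.
Proof. by rewrite trmx_mul map_mxM. Qed.

Lemma adjmxD m n (M N : 'M[C]_(m, n)) : (M + N)^t* = M^t* + N^t*.
Proof. by rewrite linearD/= map_mxD. Qed.

Lemma adjmxN m n (M : 'M[C]_(m, n)) : (- M)^t* = - M^t*.
Proof. by rewrite linearN/= map_mxN. Qed.

Lemma adjmxZ m n c (M : 'M[C]_(m, n)) : (c *: M)^t* = (c^*)%R *: M^t*.
Proof. by rewrite linearZ/= map_mxZ. Qed.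

Lemma adjmx0 m n : (0 : 'M[C]_(m, n))^t* = 0.
Proof. by rewrite trmx0 map_mx0. Qed.

Lemma adjmx_col m1 m2 n (M : 'M[C]_(m1, n)) (N : 'M[C]_(m2, n)) :
  (col_mx M N)^t* = row_mx (M^t*) (N^t*).
Proof. by rewrite tr_col_mx map_row_mx. Qed.

Lemma adjmx_block m1 m2 n1 n2 (M : 'M[C]_(m1, n1)) (N : 'M[C]_(m1, n2))
    (P : 'M[C]_(m2, n1)) (Q : 'M[C]_(m2, n2)) :
  (block_mx M N P Q)^t* = block_mx (M^t*) (P^t*) (N^t*) (Q^t*).
Proof. by rewrite tr_block_mx map_block_mx. Qed.

Lemma adjmx_unit n (M : 'M[C]_n) : (M^t* \in unitmx) = (M \in unitmx).
Proof. by rewrite map_unitmx unitmx_tr. Qed.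

Lemma adjmx_inv n (M : 'M[C]_n) : (invmx M)^t* = invmx (M^t*).
Proof. by rewrite trmx_inv map_invmx. Qed.

Lemma adjmx_entry m n (M : 'M[C]_(m, n)) i j : (M^t*) i j = ((M j i)^*)%R.
Proof. by rewrite !mxE. Qed.

Lemma hermsymmxP n (M : 'M[C]_n) : reflect (M^t* = M) (M \is hermsymmx).
Proof.
by rewrite is_hermitianmxE expr0 scale1r eq_sym; exact: eqP.
Qed.

Lemma form_addZ n (M : 'M[C]_n) (x y : 'cV[C]_n) c :
  ((x + c *: y)^t* *m M *m (x + c *: y)) 0 0 =
    (x^t* *m M *m x) 0 0 + c * (x^t* *m M *m y) 0 0
    + (c^*)%R * (y^t* *m M *m x) 0 0 + c * (c^*)%R * (y^t* *m M *m y) 0 0.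
Proof.
rewrite adjmxD adjmxZ !(mulmxDl, mulmxDr) -!(scalemxAl, scalemxAr) scalerA.
by rewrite !(mxDE, mxZE); ring.
Qed.

Lemma adjmx_mul_self_ge0 n (w : 'cV[C]_n) : 0 <= (w^t* *m w) 0 0.
Proof.
rewrite mxE; apply: sumr_ge0 => i _.
by rewrite adjmx_entry mulrC -normCK exprn_ge0.
Qed.

Lemma adjmx_mul_self_eq0 n (w : 'cV[C]_n) : (w^t* *m w) 0 0 = 0 -> w = 0.
Proof.
rewrite mxE => /eqP; rewrite psumr_eq0 => [/allP h|i _]; last first.
  by rewrite adjmx_entry mulrC -normCK exprn_ge0.
apply/colP => i; rewrite mxE; have := h i (mem_index_enum _).
by rewrite adjmx_entry mulrC -normCK /= expf_eq0/= normr_eq0 => /eqP.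
Qed.

(* Along trajectories [s] is the supply rate y^H u, and [Re a] is the
   derivative of the storage when E^H Q is Hermitian. *)
Lemma KYP_form n m (A Q : 'M[C]_n) (B : 'M[C]_(n, m)) (G : 'M[C]_(m, n))
    (D : 'M[C]_m) (v : 'cV[C]_n) (u : 'cV[C]_m) :
  let s := ((G *m v + D *m u)^t* *m u) 0 0 in
  let a := (v^t* *m Q^t* *m (A *m v + B *m u)) 0 0 in
  ((col_mx v u)^t* *m
     block_mx (- (A^t* *m Q) - Q^t* *m A) (G^t* - Q^t* *m B)
              (G - B^t* *m Q) (D + D^t*)
   *m col_mx v u) 0 0 = (s + (s^*)%R) - (a + (a^*)%R).
Proof.
move=> s a; rewrite /s /a -!adjmx_entry.
rewrite adjmx_col mul_row_block mul_row_col.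
rewrite !(adjmxM, adjmxD, trmxCK, mulmxDl, mulmxDr, mulmxN, mulNmx, mulmxA).
by rewrite !(mxDE, mxNE); ring.
Qed.

(** In a row basis of [V] the restriction of [M] is a square matrix [J] of positive size, which has
    an eigenvector because the field is algebraically closed. *)
Lemma stable_eigenvector n (V M : 'M[C]_n) : V != 0 -> stablemx V M ->
  exists2 v : 'rV[C]_n, v != 0 & (v <= V)%MS /\ exists a, v *m M = a *: v.
Proof.
move=> V0 sVM; pose W := row_base V.
have WM : (W *m M <= W)%MS.
  rewrite (eqmxMr _ (eq_row_base V)) eq_row_base; exact: sVM.
have [J WMJ] := submxP WM.
have rV : (0 < \rank V)%N by rewrite lt0n mxrank_eq0.
have [a /eigenvalueP[v vJ v0]] := eigenvalue_closed J rV.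
exists (v *m W); first by rewrite mulmx_free_eq0 ?row_base_free.
split; first by rewrite mulmx_sub// eq_row_base.
by exists a; rewrite -mulmxA WMJ mulmxA vJ scalemxAl.
Qed.

(* If [A] maps the kernel of [Q] into that of [Q^H] and [E] maps it into the
   same space, then by dimension [E] is onto and the kernel is invariant under
   [E^-1 A]. *)
Lemma kernel_pencil_eigenvector n (E A Q : 'M[C]_n) :
    E \in unitmx -> Q \notin unitmx ->
    (forall z : 'cV[C]_n, Q *m z = 0 -> Q^t* *m (E *m z) = 0) ->
    (forall z : 'cV[C]_n, Q *m z = 0 -> Q^t* *m (A *m z) = 0) ->
  exists2 z : 'cV[C]_n, z != 0 & Q *m z = 0 /\ exists a, A *m z = a *: (E *m z).
Proof.
move=> uE nQ EQ AQ.
(* Subspaces are row spaces here, so column kernels are handled through transposes. *)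
pose V := kermx Q^T; pose W := kermx (Q^t*)^T.
have inV (v : 'rV_n) : (v <= V)%MS -> Q *m v^T = 0.
  by move=> /sub_kermxP h; rewrite -[Q]trmxK -trmx_mul h trmx0.
have subW (N : 'M[C]_n) :
    (forall z : 'cV[C]_n, Q *m z = 0 -> Q^t* *m (N *m z) = 0) ->
    (V *m N^T <= W)%MS.
  move=> h; apply/row_subP => i; rewrite row_mul; apply/sub_kermxP.
  have /inV/h := row_sub i V.
  by move=> h0; apply: trmx_inj; rewrite !trmx_mul !trmxK trmx0.
(* The inclusion [V *m E^T <= W] is an equality of spaces: [E] preserves dimension, and [Q] and its
   adjoint have equal rank. *)
have VEW : (W <= V *m E^T)%MS.
  have [_ <-] := mxrank_leqif_sup (subW E EQ).
  rewrite mxrankMfree ?row_free_unit ?unitmx_tr// !mxrank_ker.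
  by rewrite !mxrank_tr mxrank_map mxrank_tr.
have V0 : V != 0.
  apply: contraNneq nQ => V0.
  have : row_free Q^T by rewrite -kermx_eq0 -/V V0.
  by rewrite row_free_unit unitmx_tr.
have sV : stablemx V (invmx E *m A)^T.
  have [H HE] := submxP (submx_trans (subW A AQ) VEW).
  rewrite trmx_mul mulmxA HE mulmxA trmx_inv mulmxK ?unitmx_tr//.
  exact: submxMl.
have [v v0 [vV [a va]]] := stable_eigenvector V0 sV.
exists v^T; first by rewrite trmx_eq0.
split; first exact: inV.
exists a; move: va => /(congr1 trmx); rewrite trmx_mul trmxK linearZ/=.
by move=> /(congr1 (mulmx E)); rewrite -!mulmxA mulKVmx// -scalemxAr.
Qed.

End MatrixForms.

(** * Closure of matrices over the chosen field under matrix operations *)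

Section ConjugateTranspose.
Context {R : realType}.
Implicit Type K : scalar_field.

Lemma mx_overM K m n p (M : 'M[R[i]]_(m, n)) (N : 'M[R[i]]_(n, p)) :
  mx_over K M -> mx_over K N -> mx_over K (M *m N).
Proof.
case: K => //= /mxOverP rM /mxOverP rN; apply/mxOverP => i j; rewrite mxE.
by apply: rpred_sum => k _; rewrite rpredM.
Qed.

Lemma mx_overD K m n (M N : 'M[R[i]]_(m, n)) :
  mx_over K M -> mx_over K N -> mx_over K (M + N).
Proof. by case: K => //=; exact: realmxD. Qed.

Lemma mx_overN K m n (M : 'M[R[i]]_(m, n)) : mx_over K M -> mx_over K (- M).
Proof.
by case: K => //= /mxOverP rM; apply/mxOverP => i j; rewrite mxE rpredN.
Qed.

Lemma mx_overZ K m n (c : R) (M : 'M[R[i]]_(m, n)) :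
  mx_over K M -> mx_over K (c%:C *: M).
Proof.
case: K => //= /mxOverP rM; apply/mxOverP => i j; rewrite mxE rpredM//.
by rewrite complex_real.
Qed.

Lemma mx_over_adj K m n (M : 'M[R[i]]_(m, n)) :
  mx_over K M -> mx_over K (M^t*).
Proof.
case: K => //= /mxOverP rM; apply/mxOverP => i j.
by rewrite !mxE; move/CrealP: (rM j i) => ->.
Qed.

Lemma mx_over_inv K n (M : 'M[R[i]]_n) : mx_over K M -> mx_over K (invmx M).
Proof.
case: K => //= rM; apply/mxOverP => i j; apply/CrealP.
(* Inversion commutes with conjugation, so the inverse of a real matrix is fixed by conjugation. *)
have := congr1 (fun N : 'M[R[i]]_n => N i j) (map_invmx (@Num.conj _) M).
by rewrite (realmxC rM) mxE.
Qed.

Lemma mx_over0 K m n : mx_over K (0 : 'M[R[i]]_(m, n)).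
Proof. by case: K => //=; apply/mxOverP => i j; rewrite mxE. Qed.

Lemma mx_over_block K m1 m2 n1 n2
    (M : 'M[R[i]]_(m1, n1)) (N : 'M[R[i]]_(m1, n2))
    (P : 'M[R[i]]_(m2, n1)) (Q : 'M[R[i]]_(m2, n2)) :
  mx_over K (block_mx M N P Q) =
  [&& mx_over K M, mx_over K N, mx_over K P & mx_over K Q].
Proof.
case: K => //=; apply/mxOverP/and4P =>
  [h|[/mxOverP rM /mxOverP rN /mxOverP rP /mxOverP rQ] i j].
  split; apply/mxOverP => i j.
  - by have := h (lshift _ i) (lshift _ j); rewrite block_mxEul.
  - by have := h (lshift _ i) (rshift _ j); rewrite block_mxEur.
  - by have := h (rshift _ i) (lshift _ j); rewrite block_mxEdl.
  - by have := h (rshift _ i) (rshift _ j); rewrite block_mxEdr.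
by rewrite !mxE; case: splitP => k _; rewrite !mxE; case: splitP.
Qed.

Lemma mx_over_col K m1 m2 n (M : 'M[R[i]]_(m1, n)) (N : 'M[R[i]]_(m2, n)) :
  mx_over K (col_mx M N) = mx_over K M && mx_over K N.
Proof.
case: K => //=; apply/mxOverP/andP => [h|[/mxOverP rM /mxOverP rN] i j].
  split; apply/mxOverP => i j.
  - by have := h (lshift _ i) j; rewrite col_mxEu.
  - by have := h (rshift _ i) j; rewrite col_mxEd.
by rewrite !mxE; case: splitP => k _.
Qed.

Lemma mx_over_row K m n1 n2 (M : 'M[R[i]]_(m, n1)) (N : 'M[R[i]]_(m, n2)) :
  mx_over K (row_mx M N) = mx_over K M && mx_over K N.
Proof.
case: K => //=; apply/mxOverP/andP => [h|[/mxOverP rM /mxOverP rN] i j].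
  split; apply/mxOverP => i j.
  - by have := h i (lshift _ j); rewrite row_mxEl.
  - by have := h i (rshift _ j); rewrite row_mxEr.
by rewrite !mxE; case: splitP => k _.
Qed.

End ConjugateTranspose.

(** * Semidefinite forms over the real and the complex field *)

Section HermitianForms.
Context {R : realType}.
Implicit Type K : scalar_field.
Notation Re := complex.Re.
Notation Im := complex.Im.

Lemma hform_adj n (M : 'M[R[i]]_n) x : hform (M^t*) x = ((hform M x)^*)%R.
Proof. by rewrite /hform -adjmx_entry !adjmxM trmxCK mulmxA. Qed.

Lemma hformD n (M N : 'M[R[i]]_n) x : hform (M + N) x = hform M x + hform N x.
Proof. by rewrite /hform mulmxDr mulmxDl mxE. Qed.

Lemma hformN n (M : 'M[R[i]]_n) x : hform (- M) x = - hform M x.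
Proof. by rewrite /hform mulmxN mulNmx mxE. Qed.

Lemma hformZ n c (M : 'M[R[i]]_n) x : hform (c *: M) x = c * hform M x.
Proof. by rewrite /hform -scalemxAr -scalemxAl mxE. Qed.

Lemma hform_addZ n (M : 'M[R[i]]_n) x y c :
  hform M (x + c *: y) = hform M x + c * (x^t* *m M *m y) 0 0
    + (c^*)%R * (y^t* *m M *m x) 0 0 + c * (c^*)%R * hform M y.
Proof.
exact: form_addZ.
Qed.

(** For [B] positive and larger than [b], the value at [- a / B] is a nonpositive multiple of
    [a ^+ 2], nonzero unless [a] is. *)
Lemma linear_term_eq0 (a b : R) :
  (forall e : R, 0 <= a * e + b * e ^+ 2) -> a = 0.
Proof.
move=> h; pose B := `|b| + 1.
have B0 : 0 < B by rewrite ltr_wpDl.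
have bB : b < B by apply: le_lt_trans (ler_norm b) _; rewrite ltrDl.
have := h (- a / B).
have -> : a * (- a / B) + b * (- a / B) ^+ 2 = - (a ^+ 2 * (B - b)) / B ^+ 2.
  by field; rewrite gt_eqF.
rewrite pmulr_lge0 ?invr_gt0 ?exprn_gt0// oppr_ge0 pmulr_lle0 ?subr_gt0// => h2.
by apply/eqP; rewrite -sqrf_eq0 eq_le h2 sqr_ge0.
Qed.

(** Moving from [z] by [e] in the direction [w = M *m z] gives the form a linear term in [e] with
    coefficient twice the squared norm of [w]; nonnegativity for both signs of [e] makes it
    vanish. *)
Lemma psd_form_kernel n (M : 'M[R[i]]_n) (z : 'cV[R[i]]_n) :
  M^t* = M -> (forall x, 0 <= hform M x) -> hform M z = 0 -> M *m z = 0.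
Proof.
move=> hM psdM Mz; apply: adjmx_mul_self_eq0.
set w := M *m z; set N := (w^t* *m w) 0 0.
have wE : w^t* = z^t* *m M by rewrite adjmxM hM.
have N_ge0 : 0 <= N by exact: adjmx_mul_self_ge0.
have expand (e : R) : hform M (z + e%:C *: w) =
    2 * N * e%:C + hform M w * e%:C ^+ 2.
  have wMz : (w^t* *m M *m z) 0 0 = N by rewrite /N -mulmxA.
  have zMw : (z^t* *m M *m w) 0 0 = N by rewrite /N wE.
  have eC : (e%:C^*)%R = e%:C by rewrite conj_Creal ?complex_real.
  by rewrite hform_addZ Mz wMz zMw eC add0r; ring.
have N_real : (Re N)%:C = N by rewrite RRe_real//; exact: ger0_real.
have w_real : (Re (hform M w))%:C = hform M w.
  by rewrite RRe_real//; exact: ger0_real (psdM w).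
rewrite -N_real (_ : Re N = 0)//.
suff : 2 * Re N = 0 by move/eqP; rewrite mulf_eq0 pnatr_eq0/= => /eqP.
apply: (@linear_term_eq0 _ (Re (hform M w))) => e.
have := psdM (z + e%:C *: w); rewrite expand -N_real -w_real -ler0c.
by rewrite expr2 rmorphD !rmorphM rmorph_nat.
Qed.

(** Nonnegative values are real, so the Hermitian matrix ['i (M ^t* - M)] has zero form on all
    complex vectors, and [psd_form_kernel] makes every vector lie in its kernel. *)
Lemma hform_ge0_herm n (M : 'M[R[i]]_n) :
  (forall x, 0 <= hform M x) -> M^t* = M.
Proof.
move=> psdM; apply/eqP; rewrite -subr_eq0; apply/eqP.
pose N := 'i%C *: (M^t* - M).
have hN0 x : hform N x = 0.
  rewrite hformZ hformD hformN hform_adj.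
  by rewrite conj_Creal ?ger0_real// subrr mulr0.
have hN : N^t* = N.
  apply/matrixP => i j; rewrite !mxE.
  case: (M i j) => a b; case: (M j i) => c d.
  apply: complex_eqP; rewrite ?(Re_conj, Im_conj, ReM, ImM, ReD, ImD)/=.
    ring.
  ring.
have Nx (x : 'cV[R[i]]_n) : N *m x = 0.
  by apply: psd_form_kernel => // y; rewrite hN0.
have N0 : N = 0.
  apply/matrixP => i j; have /colP/(_ i) := Nx (delta_mx j 0).
  by rewrite -colE mxE => ->; rewrite !mxE.
apply/eqP; move/eqP: N0; rewrite scaler_eq0 => /orP[|//].
by rewrite eq_complex /= oner_eq0 andbF.
Qed.

(** For a real symmetric matrix the cross terms at [a + 'i b] cancel, and the form is the sum of its
    values at the real vectors [a] and [b]. *)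
Lemma hform_ge0_over K n (M : 'M[R[i]]_n) : mx_over K M -> M^t* = M ->
  (forall x, mx_over K x -> 0 <= hform M x) -> forall x, 0 <= hform M x.
Proof.
case: K => [rM hM psdM x|_ _ psdM x]; last exact: psdM.
pose a : 'cV[R[i]]_n := \col_i (Re (x i 0))%:C.
pose b : 'cV[R[i]]_n := \col_i (Im (x i 0))%:C.
have ra : a \is a realmx by apply/mxOverP => i j; rewrite mxE complex_real.
have rb : b \is a realmx by apply/mxOverP => i j; rewrite mxE complex_real.
have xE : x = a + 'i%C *: b.
  by apply/colP => i; rewrite !mxE -complexE.
suff -> : hform M x = hform M a + hform M b by rewrite addr_ge0// psdM.
have abE : (a^t* *m M *m b) 0 0 = (b^t* *m M *m a) 0 0.
  rewrite -[RHS]conjCK -adjmx_entry !adjmxM trmxCK hM mulmxA.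
  apply/esym/CrealP.
  suff /mxOverP/(_ 0 0) : (a^t* *m M *m b) \is a realmx by [].
  by apply: (@mx_overM R RealField) => //; apply: (@mx_overM R RealField) => //;
    exact: (@mx_over_adj R RealField).
rewrite xE hform_addZ abE (_ : ('i%C^*)%R = - 'i%C :> R[i]); last first.
  by apply: complex_eqP; rewrite ?Re_conj ?Im_conj//= oppr0.
rewrite mulNr addrK; congr (_ + _).
by rewrite mulrN -expr2 sqr_i opprK mul1r.
Qed.

End HermitianForms.

(** * The system in decoupled coordinates *)

Section BlockSystems.
Context {C : numClosedFieldType}.

(** Inserting [Tl] and its inverse between the two factors pairs the transformed [Q] with the block
    form of [E], whose zero blocks leave only [G11] and [G12]. *)
Lemma storage_mx_block n1 n2 (Tl Tr E Q : 'M[C]_(n1 + n2)) (E1 G11 : 'M[C]_n1)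
    (G12 : 'M[C]_(n1, n2)) (G21 : 'M[C]_(n2, n1)) (G22 : 'M[C]_n2) :
    Tl \in unitmx -> Tl *m E *m Tr = block_mx E1 0 0 0 ->
    (invmx Tl)^t* *m Q *m Tr = block_mx G11 G12 G21 G22 ->
  Tr^t* *m (Q^t* *m E) *m Tr =
    block_mx (G11^t* *m E1) 0 (G12^t* *m E1) 0.
Proof.
move=> uTl bE bG.
have -> : Tr^t* *m (Q^t* *m E) *m Tr =
    ((invmx Tl)^t* *m Q *m Tr)^t* *m (Tl *m E *m Tr).
  by rewrite !adjmxM trmxCK !mulmxA mulmxKV.
by rewrite bE bG adjmx_block mulmx_block !mulmx0 !addr0.
Qed.

(** Two different vectors are allowed so that the identity serves both the storage and its rate,
    where the second vector is the derivative of the state. *)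
Lemma storage_block n1 n2 (Tl Tr E Q : 'M[C]_(n1 + n2)) (E1 G11 : 'M[C]_n1)
    (G12 : 'M[C]_(n1, n2)) (G21 : 'M[C]_(n2, n1)) (G22 : 'M[C]_n2)
    (v1 w1 : 'cV[C]_n1) (v2 w2 : 'cV[C]_n2) :
    Tl \in unitmx -> Tl *m E *m Tr = block_mx E1 0 0 0 ->
    (invmx Tl)^t* *m Q *m Tr = block_mx G11 G12 G21 G22 ->
  (Tr *m col_mx v1 v2)^t* *m (Q^t* *m E) *m (Tr *m col_mx w1 w2) =
    v1^t* *m (G11^t* *m E1) *m w1 + v2^t* *m (G12^t* *m E1) *m w1.
Proof.
move=> uTl bE bG.
have -> : (Tr *m col_mx v1 v2)^t* *m (Q^t* *m E) *m (Tr *m col_mx w1 w2) =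
    (col_mx v1 v2)^t* *m (Tr^t* *m (Q^t* *m E) *m Tr) *m col_mx w1 w2.
  by rewrite adjmxM !mulmxA.
rewrite (storage_mx_block uTl bE bG) adjmx_col.
by rewrite mul_row_block mul_row_col !mulmx0 addr0 mul0mx addr0 mulmxDl.
Qed.

Lemma congruence_herm n (P T : 'M[C]_n) :
  T \in unitmx -> (T^t* *m P *m T)^t* = T^t* *m P *m T -> P^t* = P.
Proof.
move=> uT; rewrite !adjmxM trmxCK mulmxA => h.
have uTH : T^t* \in unitmx by rewrite adjmx_unit.
by apply: (can_inj (mulKmx uTH)); apply: (can_inj (mulmxK uT)).
Qed.

(** Multiplication by [Tl] splits the equation into differential and algebraic rows; [w2] stays free
    because [E] annihilates it. Both trajectories and, with [u = 0], eigenvectors of the pencil are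
    treated this way. *)
Lemma pencil_block n1 n2 m (Tl Tr E A : 'M[C]_(n1 + n2))
    (B : 'M[C]_(n1 + n2, m)) (E1 A1 : 'M[C]_n1) (A2 : 'M[C]_n2)
    (B1 : 'M[C]_(n1, m)) (B2 : 'M[C]_(n2, m))
    (v1 w1 : 'cV[C]_n1) (v2 w2 : 'cV[C]_n2) (u : 'cV[C]_m) :
    Tl \in unitmx -> Tl *m E *m Tr = block_mx E1 0 0 0 ->
    Tl *m A *m Tr = block_mx A1 0 0 A2 -> Tl *m B = col_mx B1 B2 ->
    A2 \in unitmx ->
  E *m (Tr *m col_mx w1 w2) = A *m (Tr *m col_mx v1 v2) + B *m u <->
  E1 *m w1 = A1 *m v1 + B1 *m u /\ v2 = - (invmx A2 *m B2) *m u.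
Proof.
move=> uTl bE bA bB uA2.
have eqE : Tl *m (E *m (Tr *m col_mx w1 w2)) = col_mx (E1 *m w1) 0.
  by rewrite 2!mulmxA bE mul_block_col !mul0mx !addr0.
have eqA : Tl *m (A *m (Tr *m col_mx v1 v2) + B *m u) =
    col_mx (A1 *m v1 + B1 *m u) (A2 *m v2 + B2 *m u).
  rewrite mulmxDr 2!mulmxA bA [Tl *m (B *m u)]mulmxA bB mul_block_col.
  by rewrite mul_col_mx !mul0mx addr0 add0r add_col_mx.
split=> [/(congr1 (mulmx Tl))|[e1 e2]].
  rewrite eqE eqA => /eq_col_mx[-> /esym/eqP]; rewrite addr_eq0 => /eqP e2.
  by split=> //; rewrite -[v2](mulKmx uA2) e2 mulmxN mulNmx !mulmxA.
apply: (can_inj (mulKmx uTl)); rewrite eqE eqA e1 e2.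
by rewrite mulNmx mulmxN -mulmxA mulKVmx// addNr.
Qed.

Lemma output_block n1 n2 m (Tr : 'M[C]_(n1 + n2)) (G : 'M[C]_(m, n1 + n2))
    (G1 : 'M[C]_(m, n1)) (G2 : 'M[C]_(m, n2)) (D : 'M[C]_m)
    (F : 'M[C]_(n2, m)) (v1 : 'cV[C]_n1) (u : 'cV[C]_m) :
  G *m Tr = row_mx G1 G2 ->
  G *m (Tr *m col_mx v1 (- F *m u)) + D *m u = G1 *m v1 + (D - G2 *m F) *m u.
Proof.
move=> bG; rewrite mulmxA bG mul_row_col mulmxBl mulNmx mulmxN !mulmxA.
by rewrite [D *m u - _]addrC addrA.
Qed.

Lemma full_rank_mulmx_eq0 p n (M : 'M[C]_(p, n)) (x : 'cV[C]_n) :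
  \rank M = n -> M *m x = 0 -> x = 0.
Proof.
move=> rM Mx; apply: trmx_inj; rewrite trmx0; apply/eqP.
have fM : row_free M^T by rewrite /row_free mxrank_tr rM.
by rewrite -(mulmx_free_eq0 _ fM) -trmx_mul Mx trmx0.
Qed.

End BlockSystems.

(** * Pointwise dissipation, storage rates and linear flows *)

Section Dissipation.
Context {R : realType}.
Implicit Type K : scalar_field.
Notation Re := complex.Re.
Notation Im := complex.Im.

Lemma half_complex (z : R[i]) : 2^-1 * z = (2^-1 : R)%:C * z.
Proof. by rewrite fmorphV rmorph_nat. Qed.

Lemma Re_half (z : R[i]) : Re (2^-1 * z) = 2^-1 * Re z.
Proof. by rewrite half_complex ReM/= mul0r subr0. Qed.

Lemma affine_ge0_slope0 (a b : R[i]) :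
  (forall c : R, 0 <= a + c%:C * b) -> b = 0.
Proof.
move=> h.
have {}h c : Im a + c * Im b = 0 /\ 0 <= Re a + c * Re b.
  have := h c; rewrite lecE ReD ImD ReM ImM/= !mul0r subr0 addr0.
  by move=> /andP[/eqP].
apply: complex_eqP => /=; last by have [] := (h 0, h 1) => -[+ _] [+ _]; lra.
apply/eqP; apply: contraT => b0.
(* At this [c] the real part would equal -1. *)
have [_] := h (- (Re a + 1) / Re b).
by rewrite divfK//; lra.
Qed.

(** By [KYP_form] the form is twice the difference of the two real parts, hence always real; the
    block matrix is Hermitian by its shape. *)
Lemma KYP_psdP K n m (A Q : 'M[R[i]]_n) (B : 'M[R[i]]_(n, m))
    (G : 'M[R[i]]_(m, n)) (D : 'M[R[i]]_m) :
  psdmx K (block_mx (- (A^t* *m Q) - Q^t* *m A) (G^t* - Q^t* *m B)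
                    (G - B^t* *m Q) (D + D^t*)) <->
  (forall (v : 'cV[R[i]]_n) (u : 'cV[R[i]]_m), mx_over K v -> mx_over K u ->
     Re ((v^t* *m Q^t* *m (A *m v + B *m u)) 0 0) <=
     Re (((G *m v + D *m u)^t* *m u) 0 0)).
Proof.
have formE v u := KYP_form A Q B G D v u.
set M := block_mx _ _ _ _ in formE *.
have ge0P v u : (0 <= hform M (col_mx v u)) =
    (Re ((v^t* *m Q^t* *m (A *m v + B *m u)) 0 0) <=
     Re (((G *m v + D *m u)^t* *m u) 0 0)).
  rewrite /hform formE; move: (_ 0 0) (_ 0 0) => [p p'] [q q'].
  rewrite lecE /= [p' - p']subrr [q' - q']subrr subrr eqxx /=.
  by apply/idP/idP; lra.
split=> [[_ psdM] v u Kv Ku|h].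
  by rewrite -ge0P; apply: psdM; rewrite mx_over_col Kv.
split=> [|x]; last by rewrite -[x]vsubmxK mx_over_col ge0P => /andP[]; exact: h.
apply/hermsymmxP; rewrite /M adjmx_block !adjmxD !adjmxN !adjmxM !trmxCK.
by rewrite [- _ - _]addrC [X in block_mx _ _ _ X]addrC.
Qed.

(** The product rule yields two terms, conjugate to each other because [P] is Hermitian; half their
    sum is a real part. *)
Lemma is_derive_storage n (P : 'M[R[i]]_n) (x : R -> 'cV[R[i]]_n) (t : R) :
    P^t* = P -> smooth x ->
  is_derive t (1 : R) (fun s => Re (2^-1 * hform P (x s)))
    (Re (((x t)^t* *m P *m ddt x t) 0 0)).
Proof.
move=> hP sx; have dx := smooth_is_mxderive t sx.
have dxa := is_mxderive_adj dx.
have := is_mxderiveM dxa (is_mxderiveMl P dx).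
move=> /(_ 0 0)[dR _].
under eq_fun do rewrite Re_half /hform -mulmxA.
apply: (is_derive_eq (is_deriveZ (2^-1 : R) dR)).
rewrite mxE ReD -[((ddt x t)^t* *m _) 0 0]conjCK -adjmx_entry Re_conj.
rewrite !adjmxM trmxCK hP !mulmxA /GRing.scale/=; lra.
Qed.

Lemma continuous_storage_rate n (P : 'M[R[i]]_n) (x : R -> 'cV[R[i]]_n) :
  smooth x -> continuous (fun t => Re (((x t)^t* *m P *m ddt x t) 0 0)).
Proof.
move=> sx; apply: is_mxderive_continuous_Re => t.
apply: is_mxderiveM; last exact/smooth_is_mxderive/smooth_ddt.
apply: is_mxderiveM; last exact: is_mxderive_cst.
exact/is_mxderive_adj/smooth_is_mxderive.
Qed.

Lemma continuous_supply_rate m (u y : R -> 'cV[R[i]]_m) :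
  smooth u -> smooth y -> continuous (fun t => Re (((y t)^t* *m u t) 0 0)).
Proof.
move=> su sy; apply: is_mxderive_continuous_Re => t.
apply: is_mxderiveM; last exact: smooth_is_mxderive.
exact/is_mxderive_adj/smooth_is_mxderive.
Qed.

(** The flow is the generating function of the iterates of [M] on [z0]. Smoothness is stated for all
    linear images so that state, input and output can be read off one flow. *)
Lemma linear_flow n (M : 'M[R[i]]_n) (z0 : 'cV[R[i]]_n) :
  exists z : R -> 'cV[R[i]]_n,
    [/\ z 0 = z0, forall t, is_mxderive t z (M *m z t),
        forall p (L : 'M[R[i]]_(p, n)), smooth (fun t => L *m z t)
      & forall K, mx_over K M -> mx_over K z0 -> forall t, mx_over K (z t)].
Proof.
pose a k := iter k (mulmx M) z0.
have ba : mx_geometrically_bounded a by exact: mx_geometrically_bounded_iter.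
exists (mx_egf a); split.
- exact: mx_egf0.
- by move=> t; rewrite -mx_egf_mulmx//; exact: is_mxderive_egf.
- move=> p L; under eq_fun do rewrite -mx_egf_mulmx//.
  exact/smooth_mx_egf/mx_geometrically_bounded_mulmx.
- move=> K KM Kz t; apply: mx_over_egf.
  by elim=> [//|k IH]; exact: mx_overM.
Qed.

End Dissipation.

(** * Passivity, the KYP inequality and observability for the decoupled system *)

Section BlockForm.
Context {R : realType} (K : scalar_field) (n1 n2 m : nat).
Context (E A Tl Tr : 'M[R[i]]_(n1 + n2)) (B : 'M[R[i]]_(n1 + n2, m)).
Context (C : 'M[R[i]]_(m, n1 + n2)) (D : 'M[R[i]]_m).
Context (E1 A1 : 'M[R[i]]_n1) (A2 : 'M[R[i]]_n2).
Context (B1 : 'M[R[i]]_(n1, m)) (B2 : 'M[R[i]]_(n2, m)).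
Context (C1 : 'M[R[i]]_(m, n1)) (C2 : 'M[R[i]]_(m, n2)).
Context (E_over : mx_over K E) (A_over : mx_over K A) (B_over : mx_over K B).
Context (C_over : mx_over K C) (D_over : mx_over K D).
Context (Tl_over : mx_over K Tl) (Tr_over : mx_over K Tr).
Context (Tl_unit : Tl \in unitmx) (Tr_unit : Tr \in unitmx).
Context (E_block : Tl *m E *m Tr = block_mx E1 0 0 0).
Context (A_block : Tl *m A *m Tr = block_mx A1 0 0 A2).
Context (B_block : Tl *m B = col_mx B1 B2).
Context (C_block : C *m Tr = row_mx C1 C2).
Context (E1_unit : E1 \in unitmx) (A2_unit : A2 \in unitmx).
Notation Re := complex.Re.

Let F := invmx A2 *m B2.
Let D' := D - C2 *m F.

Let E1_over : mx_over K E1.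
Proof.
have : mx_over K (Tl *m E *m Tr) by rewrite !mx_overM.
by rewrite E_block mx_over_block => /and4P[].
Qed.

Let A_blocks_over : mx_over K A1 /\ mx_over K A2.
Proof.
have : mx_over K (Tl *m A *m Tr) by rewrite !mx_overM.
by rewrite A_block mx_over_block => /and4P[].
Qed.

Let B_blocks_over : mx_over K B1 /\ mx_over K B2.
Proof.
have : mx_over K (Tl *m B) by rewrite mx_overM.
by rewrite B_block mx_over_col => /andP[].
Qed.

Let F_over : mx_over K F.
Proof.
by apply: mx_overM;
  [apply: mx_over_inv; case: A_blocks_over|case: B_blocks_over].
Qed.

Lemma solution_block x0 (x : R -> 'cV[R[i]]_(n1 + n2)) (u y : R -> 'cV[R[i]]_m)
    (t : R) :
  solution K E A B C D x0 x u y -> 0 <= t ->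
  exists v1 w1 : 'cV[R[i]]_n1, exists w2 : 'cV[R[i]]_n2,
    [/\ mx_over K v1, x t = Tr *m col_mx v1 (- F *m u t),
        ddt x t = Tr *m col_mx w1 w2, E1 *m w1 = A1 *m v1 + B1 *m u t
      & y t = C1 *m v1 + D' *m u t].
Proof.
case=> Kxuy [sx su sy] ode _ out t0.
pose v := invmx Tr *m x t; pose w := invmx Tr *m ddt x t.
have xE : x t = Tr *m col_mx (usubmx v) (dsubmx v) by rewrite vsubmxK mulKVmx.
have wE : ddt x t = Tr *m col_mx (usubmx w) (dsubmx w).
  by rewrite vsubmxK mulKVmx.
have Kv : mx_over K (col_mx (usubmx v) (dsubmx v)).
  rewrite vsubmxK; apply: mx_overM; first exact: mx_over_inv.
  by have /and3P[] := Kxuy t.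
have := ode t t0.
rewrite (is_mxderive_ddt (is_mxderiveMl E (smooth_is_mxderive t sx))) xE wE.
move=> /(pencil_block _ _ _ _ _ Tl_unit E_block A_block B_block A2_unit)[e1 e2].
exists (usubmx v), (usubmx w), (dsubmx w).
move: Kv; rewrite mx_over_col => /andP[Kv _].
by split=> //; rewrite -?e2// out// xE e2 (output_block _ _ _ _ C_block).
Qed.

Lemma passive_of_KYP (Q1 : 'M[R[i]]_n1) :
    mx_over K Q1 -> modified_KYP K E1 A1 A2 B1 B2 C1 C2 D Q1 ->
    E1^t* *m Q1 \is hermsymmx ->
  passive K E A B C D.
Proof.
move=> KQ [/= psdM storage1]; rewrite -!mulmxA -/F -/D' in psdM.
move=> /hermsymmxP hP1.
have dissip := (KYP_psdP _ _ _ _ _ _).1 psdM.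
(* Chosen so that in block coordinates [Q] has [Q1] as its only nonzero block; the storage then
   depends on [v1] alone. *)
pose Q := Tl^t* *m block_mx Q1 0 0 0 *m invmx Tr.
have QG : (invmx Tl)^t* *m Q *m Tr = block_mx Q1 0 0 0.
  by rewrite /Q adjmx_inv !mulmxA mulVmx ?adjmx_unit// mul1mx mulmxKV.
have P1E : Q1^t* *m E1 = E1^t* *m Q1 by rewrite -[RHS]hP1 adjmxM trmxCK.
pose P := Q^t* *m E.
have formE (v1 w1 : 'cV[R[i]]_n1) (v2 w2 : 'cV[R[i]]_n2) :
    (Tr *m col_mx v1 v2)^t* *m P *m (Tr *m col_mx w1 w2) =
    v1^t* *m (E1^t* *m Q1) *m w1.
  rewrite (storage_block _ _ _ _ Tl_unit E_block QG) P1E adjmx0.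
  by rewrite mul0mx mulmx0 mul0mx addr0.
have hP : P^t* = P.
  apply: (congruence_herm Tr_unit).
  rewrite (storage_mx_block Tl_unit E_block QG) P1E adjmx0 mul0mx.
  by rewrite adjmx_block !adjmx0 hP1.
exists Q; split.
  apply: mx_overM; last exact: mx_over_inv.
  by apply: mx_overM; [exact: mx_over_adj|rewrite mx_over_block !mx_over0 KQ].
move=> x0 _ x u y sol.
have storageE T : 0 <= T -> 0 <= storage E Q (x T).
  move=> /(solution_block sol)[v1 [w1 [w2 [Kv -> _ _ _]]]].
  rewrite /storage mulr_ge0 ?invr_ge0//.
  by rewrite /hform -/P formE; exact: storage1.
move=> T T0; split; last exact: storageE.
have [_ [sx su sy] _ _ _] := sol.
(* Nonnegative values are real, which moves the inequality from [R[i]] to [R]. *)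
have storageR t : 0 <= t -> storage E Q (x t) = (Re (storage E Q (x t)))%:C.
  by move=> /storageE/ger0_real/RRe_real.
rewrite storageR// [storage E Q (x 0)]storageR// -rmorphB lecR.
apply: (@is_derive_increment_le R (fun t => Re (2^-1 * hform P (x t)))
  (fun t => Re (((x t)^t* *m P *m ddt x t) 0 0))
  (fun t => Re (((y t)^t* *m u t) 0 0))) => //.
- by move=> t; exact: is_derive_storage.
- exact: continuous_storage_rate.
- exact: continuous_supply_rate.
move=> t t0.
have [v1 [w1 [w2 [Kv xE wE ode ->]]]] := solution_block sol t0.
rewrite xE wE formE -P1E -mulmxA -[Q1^t* *m _ *m _]mulmxA ode mulmxA.
have [/(_ t)/and3P[_ Ku _] _ _ _ _] := sol; exact: dissip.
Qed.

(** With constant input and [E1] invertible, [v] solves a linear equation with free initial value;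
    the algebraic component and the output follow from [v] and [u]. *)
Lemma trajectory (v0 : 'cV[R[i]]_n1) (u0 : 'cV[R[i]]_m) :
    mx_over K v0 -> mx_over K u0 ->
  exists (v : R -> 'cV[R[i]]_n1) (x : R -> 'cV[R[i]]_(n1 + n2))
         (u y : R -> 'cV[R[i]]_m),
    [/\ [/\ v 0 = v0, u 0 = u0 & smooth v],
        forall t, mx_over K (v t),
        forall t, E1 *m ddt v t = A1 *m v t + B1 *m u t,
        forall t, x t = Tr *m col_mx (v t) (- F *m u t)
      & solution K E A B C D (x 0) x u y].
Proof.
move=> Kv0 Ku0.
(* The flow of [M] carries the state together with a constant input. *)
pose M := block_mx (invmx E1 *m A1) (invmx E1 *m B1) 0 (0 : 'M[R[i]]_m).
have [z [z0 dz sz Kz]] := linear_flow M (col_mx v0 u0).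
have {}Kz : forall t, mx_over K (z t).
  apply: Kz; last by rewrite mx_over_col Kv0.
  have iE1 := mx_over_inv E1_over.
  have [[KA1 _] [KB1 _]] := (A_blocks_over, B_blocks_over).
  by rewrite mx_over_block !mx_over0 !mx_overM.
pose Lv : 'M[R[i]]_(n1, n1 + m) := row_mx 1%:M 0.
pose Lu : 'M[R[i]]_(m, n1 + m) := row_mx 0 1%:M.
pose Lx := Tr *m col_mx Lv (- F *m Lu).
have LvE w : Lv *m w = usubmx w.
  by rewrite -[in LHS](vsubmxK w) mul_row_col mul1mx mul0mx addr0.
have LuE w : Lu *m w = dsubmx w.
  by rewrite -[in LHS](vsubmxK w) mul_row_col mul1mx mul0mx add0r.
have LxE w : Lx *m w = Tr *m col_mx (usubmx w) (- F *m dsubmx w).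
  by rewrite -mulmxA mul_col_mx -(mulmxA (- F)) LvE LuE.
have Kzz t : mx_over K (usubmx (z t)) /\ mx_over K (dsubmx (z t)).
  by apply/andP; rewrite -mx_over_col vsubmxK.
have Mz t : M *m z t = col_mx
    (invmx E1 *m (A1 *m usubmx (z t) + B1 *m dsubmx (z t))) 0.
  rewrite -[in LHS](vsubmxK (z t)) mul_block_col !mul0mx addr0.
  by rewrite mulmxDr !mulmxA.
have dv t : ddt (fun s => Lv *m z s) t =
    invmx E1 *m (A1 *m usubmx (z t) + B1 *m dsubmx (z t)).
  by rewrite (is_mxderive_ddt (is_mxderiveMl Lv (dz t))) Mz LvE col_mxKu.
exists (fun t => Lv *m z t), (fun t => Lx *m z t), (fun t => Lu *m z t),
  (fun t => (C *m Lx + D *m Lu) *m z t); split.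
- by split; rewrite ?z0 ?LvE ?LuE ?col_mxKu ?col_mxKd.
- by move=> t; rewrite LvE; have [] := Kzz t.
- by move=> t; rewrite dv (mulKVmx E1_unit) LvE LuE.
- by move=> t; rewrite LxE LvE LuE.
- split=> // [t|t t0|t _].
  + have [Kv Ku] := Kzz t.
    have Kx : mx_over K (Lx *m z t).
      rewrite LxE; apply: (mx_overM Tr_over); rewrite mx_over_col Kv.
      exact: mx_overM (mx_overN F_over) Ku.
    rewrite Kx LuE Ku mulmxDl -(mulmxA C) -(mulmxA D) LuE.
    exact: mx_overD (mx_overM C_over Kx) (mx_overM D_over Ku).
  + rewrite (is_mxderive_ddt (is_mxderiveMl E (is_mxderiveMl Lx (dz t)))).
    rewrite Mz !LxE LuE col_mxKu.
    apply/(pencil_block _ _ _ _ _ Tl_unit E_block A_block B_block A2_unit).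
    by rewrite mulKVmx.
  + by rewrite mulmxDl !mulmxA.
Qed.

Lemma KYP_of_passive : passive K E A B C D ->
  exists Q1 : 'M[R[i]]_n1,
    [/\ mx_over K Q1, modified_KYP K E1 A1 A2 B1 B2 C1 C2 D Q1
      & E1^t* *m Q1 \is hermsymmx].
Proof.
move=> [Q [KQ pas]].
(* A solution witnesses the consistency of its own initial value. *)
have pas' x0 x u y (sol : solution K E A B C D x0 x u y) :=
  pas x0 (ex_intro _ x (ex_intro _ u (ex_intro _ y sol))) x u y sol.
pose G := (invmx Tl)^t* *m Q *m Tr.
have QG : (invmx Tl)^t* *m Q *m Tr =
    block_mx (ulsubmx G) (ursubmx G) (dlsubmx G) (drsubmx G) by rewrite submxK.
have : mx_over K G.
  apply: (mx_overM _ Tr_over); apply: (mx_overM _ KQ).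
  exact: mx_over_adj (mx_over_inv Tl_over).
rewrite {1}[G]QG mx_over_block => /and4P[KG11 _ _ _].
move: (ulsubmx G) (ursubmx G) (dlsubmx G) (drsubmx G) KG11 QG.
move=> G11 G12 G21 G22 KG11 QG {G}.
pose P := G11^t* *m E1.
have storageE (v : 'cV[R[i]]_n1) (w : 'cV[R[i]]_n2) :
    storage E Q (Tr *m col_mx v w) =
    2^-1 * (hform P v + (w^t* *m (G12^t* *m E1) *m v) 0 0).
  by rewrite /storage /hform (storage_block _ _ _ _ Tl_unit E_block QG) mxDE.
(* Scaling the input by a real [c] makes the nonnegative storage at time 0, up to the factor one
   half, affine in [c] with the coupling term as slope. *)
have coupling0 (v : 'cV[R[i]]_n1) (u : 'cV[R[i]]_m) :
    mx_over K v -> mx_over K u ->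
    ((- F *m u)^t* *m (G12^t* *m E1) *m v) 0 0 = 0.
  move=> Kv Ku; apply: (@affine_ge0_slope0 _ (hform P v)) => c.
  have [v' [x [u' [y [[v'0 u'0 _] _ _ xE sol]]]]] :=
    trajectory Kv (mx_overZ c Ku).
  have [_] := pas' _ _ _ _ sol 0 (lexx _).
  rewrite xE v'0 u'0 storageE pmulr_rge0 ?invr_gt0//.
  rewrite -scalemxAr adjmxZ conj_Creal ?complex_real//.
  by rewrite -2!scalemxAl mxZE.
have {}storageE (v : 'cV[R[i]]_n1) (u : 'cV[R[i]]_m) :
    mx_over K v -> mx_over K u ->
    storage E Q (Tr *m col_mx v (- F *m u)) = 2^-1 * hform P v.
  by move=> Kv Ku; rewrite storageE coupling0// addr0.
have P_ge0 (v : 'cV[R[i]]_n1) : mx_over K v -> 0 <= hform P v.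
  move=> Kv; have K0 := mx_over0 (R := R) K m 1.
  have [v' [x [u' [y [[v'0 u'0 _] _ _ xE sol]]]]] := trajectory Kv K0.
  have [_] := pas' _ _ _ _ sol 0 (lexx _).
  by rewrite xE v'0 u'0 storageE// pmulr_rge0 ?invr_gt0.
(* Over the reals [P] need not be symmetric; its Hermitian part has the same form on vectors over
   [K]. *)
pose Ps := (2^-1 : R)%:C *: (P + P^t*).
have hPs : Ps^t* = Ps.
  rewrite adjmxZ conj_Creal; last by rewrite complex_real.
  by rewrite adjmxD trmxCK addrC.
have KPs : mx_over K Ps.
  have KP : mx_over K P := mx_overM (mx_over_adj KG11) E1_over.
  exact: mx_overZ (mx_overD KP (mx_over_adj KP)).
have PsE v : mx_over K v -> hform Ps v = hform P v.
  move=> Kv; rewrite hformZ hformD hform_adj conj_Creal ?ger0_real ?P_ge0//.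
  by rewrite -half_complex -mulr2n -[hform P v *+ 2]mulr_natl mulKf ?pnatr_eq0.
(* Solves [E1^t* *m Q1 = Ps], so that the reduced storage matrix is Hermitian. *)
pose Q1 := invmx (E1^t*) *m Ps.
have Q1H : Q1^t* = Ps *m invmx E1 by rewrite adjmxM hPs adjmx_inv trmxCK.
have E1Q1 : E1^t* *m Q1 = Ps by rewrite mulKVmx// adjmx_unit.
exists Q1; split.
- exact: mx_overM (mx_over_inv (mx_over_adj E1_over)) KPs.
- split=> /=; last by move=> v Kv; rewrite E1Q1 PsE// P_ge0.
  rewrite -!mulmxA -/F -/D'; apply/KYP_psdP => v0 u0 Kv0 Ku0.
  have [v [x [u [y [[<- <- sv] Kv ode xE sol]]]]] := trajectory Kv0 Ku0.
  have [Kxuy [sx su sy] _ _ out] := sol.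
  (* Replacing [A1 v + B1 u] by [E1] times the derivative cancels [invmx E1] in the adjoint of [Q1];
     the left side becomes the storage rate at time 0. *)
  rewrite -ode Q1H !mulmxA mulmxKV//.
  have -> : C1 *m v 0 + D' *m u 0 = y 0.
    by rewrite out// xE (output_block _ _ _ _ C_block).
  apply: (@is_derive_le_of_increment R (fun t => Re (2^-1 * hform Ps (v t)))
    (fun t => Re (((v t)^t* *m Ps *m ddt v t) 0 0))
    (fun t => Re (((y t)^t* *m u t) 0 0))).
  + by move=> t; exact: is_derive_storage.
  + exact: continuous_storage_rate.
  + exact: continuous_supply_rate.
  + move=> T T0.
    have [+ _] := pas' _ _ _ _ sol T T0.
    have Ku t : mx_over K (u t) by have /and3P[] := Kxuy t.
    have sE t : storage E Q (x t) = 2^-1 * hform Ps (v t).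
      by rewrite xE (storageE _ _ (Kv t) (Ku t)) (PsE _ (Kv t)).
    rewrite !sE lecE => /andP[_].
    rewrite ReD [Re (- _)](_ : _ = - Re (2^-1 * hform Ps (v 0)))//.
    by case: (_ * _).
- by rewrite E1Q1; exact/hermsymmxP.
Qed.

Lemma KYP_unitmx (Q1 : 'M[R[i]]_n1) :
    behaviorally_observable E A C -> mx_over K Q1 ->
    modified_KYP K E1 A1 A2 B1 B2 C1 C2 D Q1 ->
  Q1 \in unitmx.
Proof.
move=> obs KQ [/= [/hermsymmxP hM psdM] storage1].
rewrite -!mulmxA -/F -/D' in hM psdM.
case: (boolP (Q1 \in unitmx)) => [//|nQ]; exfalso.
have [KA1 _] := A_blocks_over; have [KB1 _] := B_blocks_over.
have := mx_overM C_over Tr_over.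
rewrite C_block mx_over_row => /andP[KC1 KC2].
have KD' : mx_over K D' := mx_overD D_over (mx_overN (mx_overM KC2 F_over)).
(* Over the reals [E1^t* *m Q1] may fail to be symmetric here, so its Hermitian part, doubled, is
   used instead. *)
pose N := E1^t* *m Q1 + (E1^t* *m Q1)^t*.
have hN : N^t* = N by rewrite adjmxD trmxCK addrC.
have KN : mx_over K N.
  have KP := mx_overM (mx_over_adj E1_over) KQ.
  exact: mx_overD KP (mx_over_adj KP).
(* The eigenvector found below may be complex even for a real system, so both semidefinite forms are
   extended to all complex vectors. *)
have N_ge0 : forall x, 0 <= hform N x.
  apply: (hform_ge0_over KN hN) => x Kx.
  by rewrite hformD hform_adj addr_ge0 ?conjC_ge0 ?storage1.
set M := block_mx _ _ _ _ in hM psdM.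
have KM : mx_over K M.
  have KQH := mx_over_adj KQ.
  rewrite mx_over_block; apply/and4P; split.
  - exact: mx_overD (mx_overN (mx_overM (mx_over_adj KA1) KQ))
      (mx_overN (mx_overM KQH KA1)).
  - exact: mx_overD (mx_over_adj KC1) (mx_overN (mx_overM KQH KB1)).
  - exact: mx_overD KC1 (mx_overN (mx_overM (mx_over_adj KB1) KQ)).
  - exact: mx_overD KD' (mx_over_adj KD').
have M_ge0 := hform_ge0_over KM hM psdM.
have zQ (z : 'cV[R[i]]_n1) : Q1 *m z = 0 -> z^t* *m Q1^t* = 0.
  by move=> Qz; rewrite -adjmxM Qz adjmx0.
have EQ (z : 'cV[R[i]]_n1) : Q1 *m z = 0 -> Q1^t* *m (E1 *m z) = 0.
  (* On the kernel of [Q1] the form of [N] vanishes, and [N *m z] reduces to the adjoint summand. *)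
  move=> Qz; have := psd_form_kernel hN N_ge0 (z := z).
  rewrite /hform /N adjmxM trmxCK -mulmxA mulmxDl -!mulmxA Qz mulmx0 add0r.
  rewrite mulmxA zQ// mul0mx mxE; exact.
have AQ (z : 'cV[R[i]]_n1) : Q1 *m z = 0 ->
    Q1^t* *m (A1 *m z) = 0 /\ C1 *m z = 0.
  move=> Qz.
  (* This vector is isotropic for [M], hence in its kernel, and both blocks of the product
     vanish. *)
  have Mz : M *m col_mx z 0 = col_mx (- (Q1^t* *m (A1 *m z))) (C1 *m z).
    rewrite mul_block_col !mulmx0 !addr0 !mulmxBl mulNmx -!mulmxA Qz !mulmx0.
    by rewrite oppr0 add0r subr0.
  have := psd_form_kernel hM M_ge0 (z := col_mx z 0).
  rewrite /hform -mulmxA Mz adjmx_col mul_row_col adjmx0 mul0mx addr0 mulmxN.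
  rewrite mulmxA zQ// mul0mx oppr0 mxE => /(_ erefl) /eqP.
  by rewrite col_mx_eq0 oppr_eq0 => /andP[/eqP-> /eqP->].
have [z z0 [Qz [a Az]]] := kernel_pencil_eigenvector E1_unit nQ EQ
  (fun z Qz => (AQ z Qz).1).
have C1z := (AQ z Qz).2.
case/negP: z0; apply/eqP.
(* Padding by zero lifts [z] to a vector killed by both [a *: E - A] and [C], so the rank condition
   at [a] makes it zero. *)
pose x := Tr *m col_mx z (0 : 'cV[R[i]]_n2).
have x0 : x = 0.
  apply: (full_rank_mulmx_eq0 (obs a)).
  have aE : Tr *m col_mx (a *: z) (0 : 'cV[R[i]]_n2) = a *: x.
    by rewrite scalemxAr scale_col_mx scaler0.
  have : E *m (Tr *m col_mx (a *: z) 0) = A *m x + B *m 0.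
    apply/(pencil_block _ _ _ _ _ Tl_unit E_block A_block B_block A2_unit).
    by rewrite !mulmx0 addr0 -scalemxAr Az.
  rewrite aE mulmx0 addr0 -scalemxAr => Ex.
  rewrite mul_col_mx mulmxBl -scalemxAl Ex subrr.
  by rewrite mulmxA C_block mul_row_col C1z mulmx0 addr0 col_mx0.
have : col_mx z (0 : 'cV[R[i]]_n2) = 0.
  by rewrite -[LHS](mulKmx Tr_unit) -/x x0 mulmx0.
by move=> /eqP; rewrite col_mx_eq0 => /andP[/eqP].
Qed.

End BlockForm.

(* For K = C the last inequality of modified_KYP already makes E1 ^t* *m Q1
   Hermitian. For K = R it only bounds the symmetric part of E1 ^t* *m Q1, and
   the equivalence fails unless symmetry is required as well. *)
Theorem proposition4p3 (R : realType) (K : scalar_field) (n1 n2 m : nat)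
    (E A : 'M[R[i]]_(n1 + n2)) (B : 'M[R[i]]_(n1 + n2, m))
    (C : 'M[R[i]]_(m, n1 + n2)) (D : 'M[R[i]]_m)
    (Tl Tr : 'M[R[i]]_(n1 + n2))
    (E1 A1 : 'M[R[i]]_n1) (A2 : 'M[R[i]]_n2)
    (B1 : 'M[R[i]]_(n1, m)) (B2 : 'M[R[i]]_(n2, m))
    (C1 : 'M[R[i]]_(m, n1)) (C2 : 'M[R[i]]_(m, n2))
    (E_over : mx_over K E) (A_over : mx_over K A) (B_over : mx_over K B)
    (C_over : mx_over K C) (D_over : mx_over K D)
    (EA_regular : regular E A) (EA_index : index_le1 E A)
    (Tl_over : mx_over K Tl) (Tr_over : mx_over K Tr)
    (Tl_unit : Tl \in unitmx) (Tr_unit : Tr \in unitmx)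
    (E_block : Tl *m E *m Tr = block_mx E1 0 0 0)
    (A_block : Tl *m A *m Tr = block_mx A1 0 0 A2)
    (B_block : Tl *m B = col_mx B1 B2)
    (C_block : C *m Tr = row_mx C1 C2)
    (E1_unit : E1 \in unitmx) (A2_unit : A2 \in unitmx) :
  ((exists Q1 : 'M[R[i]]_n1,
      [/\ mx_over K Q1, modified_KYP K E1 A1 A2 B1 B2 C1 C2 D Q1
        & K = RealField -> E1 ^t* *m Q1 \is hermsymmx])
   <-> passive K E A B C D)
  /\
  (behaviorally_observable E A C ->
   forall Q1 : 'M[R[i]]_n1,
     mx_over K Q1 -> modified_KYP K E1 A1 A2 B1 B2 C1 C2 D Q1 ->
     Q1 \in unitmx).
Proof.
split; last first.
  move=> obs Q1 KQ kyp.
  exact: (KYP_unitmx E_over A_over B_over C_over D_over Tl_over Tr_over Tl_unit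
    Tr_unit E_block A_block B_block C_block E1_unit A2_unit obs KQ kyp).
split=> [[Q1 [KQ kyp herm]]|pas].
  apply: (passive_of_KYP Tl_over Tr_over Tl_unit Tr_unit E_block A_block B_block
    C_block A2_unit KQ kyp).
  have [_ storage_ge0] := kyp.
  apply/hermsymmxP; case: (K) herm storage_ge0 => [h _|_ h].
    by apply/hermsymmxP; exact: h.
  by apply: hform_ge0_herm => x; exact: h.
have [Q1 [KQ kyp herm]] := KYP_of_passive E_over A_over B_over C_over D_over
  Tl_over Tr_over Tl_unit E_block A_block B_block C_block E1_unit A2_unit pas.
by exists Q1.
Qed.
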